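(* For a lattice-ordered aic-semiring $R$ the following statements are equivalent: (i) $R$ is ideal-simple; (ii) $R$ is congruence-simple; (iii) $R$ is simple; (iv) $R\cong\mathbf{B}$.
   Context: A semiring $(R,+,\cdot,0,1)$ consists of a commutative monoid $(R,+,0)$ and a monoid $(R,\cdot,1)$ such that multiplication distributes over addition on both sides and $0r=0=r0$ for all $r\in R$. An ideal is an additive submonoid closed under left and right multiplication by elements of $R$. $R$ is ideal-simple if $0$ and $R$ are its only ideals; congruence-simple if the diagonal and $R^2$ are its only congruences; simple if it is both. $R$ is an aic-semiring (additively idempotent chain semiring) if $x+x=x$ for all $x\in R$ and the partial order defined by $x\le y\iff x+y=y$ is total. $R$ is lattice-ordered if there is also a lattice structure $(R,\vee,\wedge)$ on $R$ such that $a+b=a\vee b$ and $ab\le a\wedge b$ for all $a,b\in R$, where $\le$ is the partial order naturally induced by the lattice operations. $\mathbf{B}=\{0,1\}$ is the Boolean semifield ($1+1=1$).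
   Formalization: The semiring R is assumed nontrivial (1 ≠ 0), since the one-element semiring is a lattice-ordered aic-semiring that satisfies (i)–(iii) but is not isomorphic to B. *)

(* Defs.v *)
From HB Require Import structures.
From mathcomp Require Import all_boot all_order all_algebra.
From mathcomp Require Import boolp classical_sets.

Set Implicit Arguments.
Unset Strict Implicit.
Unset Printing Implicit Defensive.

Import Order.TTheory GRing.Theory.

Local Open Scope classical_set_scope.
Local Open Scope ring_scope.

(* Ideals and congruences are Prop-valued (arbitrary subsets of R and of       *)
(* R * R), as boolean predicates would only capture the decidable ones.        *)
Record is_ideal (R : pzSemiRingType) (I : set R) : Prop := IsIdeal {
  ideal0 : I 0;
  idealD : forall x y, I x -> I y -> I (x + y);
  idealMl : forall r x, I x -> I (r * x);
  idealMr : forall r x, I x -> I (x * r) }.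

Record is_congruence (R : pzSemiRingType) (c : set (R * R)) : Prop :=
  IsCongruence {
  congruence_refl : forall x, c (x, x);
  congruence_sym : forall x y, c (x, y) -> c (y, x);
  congruence_trans : forall y x z, c (x, y) -> c (y, z) -> c (x, z);
  congruenceD : forall x x' y y',
    c (x, x') -> c (y, y') -> c (x + y, x' + y');
  congruenceM : forall x x' y y',
    c (x, x') -> c (y, y') -> c (x * y, x' * y') }.

(* The zero semiring satisfies the three notions of simplicity below. It is    *)
(* excluded where needed by requiring an nzSemiRingType (1 != 0).              *)
Definition ideal_simple (R : pzSemiRingType) : Prop :=
  forall I : set R, is_ideal I -> I = [set 0] \/ I = setT.

Definition congruence_simple (R : pzSemiRingType) : Prop :=
  forall c : set (R * R), is_congruence c -> c = diagonal \/ c = setT.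

Definition simple_semiring (R : pzSemiRingType) : Prop :=
  ideal_simple R /\ congruence_simple R.

Definition add_le (R : pzSemiRingType) : rel R := fun x y => x + y == y.

(* Idempotence makes add_le a partial order, so only totality is required.     *)
Definition aic_semiring (R : pzSemiRingType) : Prop :=
  (forall x : R, x + x = x) /\ total (@add_le R).

(* A lattice structure on the carrier of R is an instance of the library's     *)
(* lattice class on that type; the order is the one of the lattice.            *)
Definition lattice_ordered (R : pzSemiRingType) : Prop :=
  exists (d : Order.disp_t) (c : Order.Lattice d R),
    let L : latticeType d := Order.Lattice.Pack c in
    forall a b : R,
      a + b = Order.join (a : L) (b : L)
      /\ Order.le (a * b : L) (Order.meet (a : L) (b : L)).

(* An alias is needed because bool already carries the field structure of F_2. *)
Definition boolean_semifield : Type := bool.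

HB.instance Definition _ := Choice.copy boolean_semifield bool.

Fact boolean_semifield_oner_neq0 : true != false :> boolean_semifield.
Proof. by []. Qed.

HB.instance Definition _ := GRing.isNmodule.Build boolean_semifield
  orbA orbC orFb.
HB.instance Definition _ :=
  GRing.Nmodule_isComNzSemiRing.Build boolean_semifield
    andbA andbC andTb andb_orl andFb boolean_semifield_oner_neq0.

Definition semiring_isomorphic (R S : pzSemiRingType) : Prop :=
  exists f : {rmorphism R -> S}, bijective f.

(* Main.v *)
Require Import Defs.
From HB Require Import structures.
From mathcomp Require Import all_boot all_order all_algebra.
From mathcomp Require Import boolp classical_sets.

(** Since [a * b] lies below both [a] and [b], the unit is the top element, and
    for every [a] the down-set of [a] is an ideal and [x + a = y + a] is a
    congruence in [x, y]. Under either form of simplicity these must be trivial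
    or total, which forces [a] to be [0] or [1], so that [R = {0, 1}] with
    [1 + 1 = 1]. *)

Set Implicit Arguments.
Unset Strict Implicit.
Unset Printing Implicit Defensive.

Import Order.TTheory GRing.Theory.
Local Open Scope classical_set_scope.
Local Open Scope ring_scope.

Definition zero_or_one (R : pzSemiRingType) : Prop :=
  forall x : R, x = 0 \/ x = 1.

Section LatticeOrdered.
Variables (R : pzSemiRingType) (latR : lattice_ordered R).

Lemma lattice_ordered_addxx (x : R) : x + x = x.
Proof.
by case: latR => d [c H]; rewrite (H x x).1 (@joinxx _ (Order.Lattice.Pack c)).
Qed.

(** This is [x * y <= x] in additive form: join is addition, so from here on the order can be
    handled by semiring equations alone. *)
Lemma lattice_ordered_mul_addl (x y : R) : x * y + x = x.
Proof.
case: latR => d [c H]; rewrite (H _ _).1.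
apply: (@join_r _ (Order.Lattice.Pack c)).
exact: le_trans (H x y).2 (leIl _ _).
Qed.

Lemma lattice_ordered_mul_addr (x y : R) : x * y + y = y.
Proof.
case: latR => d [c H]; rewrite (H _ _).1.
apply: (@join_r _ (Order.Lattice.Pack c)).
exact: le_trans (H x y).2 (leIr _ _).
Qed.

Lemma lattice_ordered_add1 (x : R) : 1 + x = 1.
Proof. by rewrite addrC -{1}[x]mulr1 lattice_ordered_mul_addr. Qed.

Lemma down_set_ideal (a : R) : is_ideal [set x : R | x + a = a].
Proof.
split=> /=; first by rewrite add0r.
- by move=> x y xa ya; rewrite -addrA ya.
- by move=> r x xa; rewrite -xa addrA lattice_ordered_mul_addr.
- by move=> r x xa; rewrite -xa addrA lattice_ordered_mul_addl.
Qed.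

Lemma add_congruence (a : R) :
  is_congruence [set p : R * R | p.1 + a = p.2 + a].
Proof.
split=> //= [y x z -> //|x x' y y' xx' yy'|x x' y y' xx' yy'].
  by rewrite -addrA yy' addrCA xx' addrCA addrA.
(* Every cross term of the expanded product has a factor [a], so it lies below [a] and is absorbed.
   Hence [u * v + a] depends only on [u + a] and [v + a]. *)
have mulDa (u v : R) : (u + a) * (v + a) + a = u * v + a.
  rewrite mulrDr 2!mulrDl -!addrA lattice_ordered_mul_addr.
  by rewrite lattice_ordered_mul_addr lattice_ordered_mul_addl.
by rewrite -mulDa xx' yy' mulDa.
Qed.

Lemma ideal_simple_zero_or_one : ideal_simple R -> zero_or_one R.
Proof.
move=> simR a; case: (simR _ (down_set_ideal a)) => Ia.
  have : [set x : R | x + a = a] a by exact: lattice_ordered_addxx.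
  by rewrite Ia; left.
(* Now [1 <= a], while [1] is the top element. *)
right; have : [set x : R | x + a = a] 1 by rewrite Ia.
by rewrite /= lattice_ordered_add1.
Qed.

Lemma congruence_simple_zero_or_one : congruence_simple R -> zero_or_one R.
Proof.
move=> simR a; case: (simR _ (add_congruence a)) => ca.
  (* By idempotence [a] is always congruent to [0], so a diagonal congruence forces [a = 0]. *)
  have : [set p : R * R | p.1 + a = p.2 + a] (a, 0).
    by rewrite /= lattice_ordered_addxx add0r.
  by rewrite ca => a0; left.
right; have : [set p : R * R | p.1 + a = p.2 + a] (0, 1) by rewrite ca.
by rewrite /= add0r lattice_ordered_add1.
Qed.

End LatticeOrdered.

Lemma zero_or_one_ideal_simple (R : pzSemiRingType) :
  zero_or_one R -> ideal_simple R.
Proof.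
move=> R01 I idI; have [I1|nI1] := pselect (I 1); [right|left].
  by apply/seteqP; split=> // x _; rewrite -[x]mulr1; exact: idealMl.
apply/seteqP; split=> x /= => [Ix|->]; last exact: ideal0.
by case: (R01 x) => // x1; rewrite x1 in Ix.
Qed.

(** The only pairs off the diagonal are [(0, 1)] and its mirror image, so a congruence is determined
    by whether it contains [(0, 1)]. *)
Lemma zero_or_one_congruence_simple (R : pzSemiRingType) :
  zero_or_one R -> congruence_simple R.
Proof.
move=> R01 c cc; have [c01|nc01] := pselect (c (0, 1)); [right|left].
  apply/seteqP; split=> // -[x y] _.
  case: (R01 x) (R01 y) => -> [] -> //; try exact: congruence_refl.
  exact: congruence_sym.
apply/seteqP; split=> -[x y]; rewrite /diagonal /=; last first.
  by move=> ->; exact: congruence_refl.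
move=> cxy; case: (R01 x) (R01 y) cxy => -> [] -> //.
by move=> /(congruence_sym cc) /nc01.
Qed.

(** The equation [1 + 1 = 1] rules out the field with two elements. *)
Lemma zero_or_one_isomorphic (R : nzSemiRingType) :
  (1 + 1 = 1 :> R) -> zero_or_one R -> semiring_isomorphic R boolean_semifield.
Proof.
move=> add11 R01; pose f (x : R) : boolean_semifield := x != 0.
have f0 : f 0 = 0 by rewrite /f eqxx.
have f1 : f 1 = 1 by rewrite /f oner_neq0.
have fD : nmod_morphism f.
  split=> // x y; case: (R01 x) (R01 y) => -> [] ->;
    by rewrite ?add0r ?addr0 ?add11 ?f0 ?f1.
have fM : monoid_morphism f.
  split=> // x y; case: (R01 x) (R01 y) => -> [] ->;
    by rewrite ?mul0r ?mulr0 ?mulr1 ?f0 ?f1.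
pose fa := GRing.isNmodMorphism.Build R boolean_semifield f fD.
pose fm := GRing.isMonoidMorphism.Build R boolean_semifield f fM.
pose F : {rmorphism R -> boolean_semifield} := HB.pack f fa fm.
exists F; exists (fun b : boolean_semifield => if b then 1 else 0) => [x|b].
  by rewrite /F /=; case: (R01 x) => ->; rewrite ?f0 ?f1.
by rewrite /F /=; case: b; rewrite ?f0 ?f1.
Qed.

Lemma isomorphic_zero_or_one (R : pzSemiRingType) :
  semiring_isomorphic R boolean_semifield -> zero_or_one R.
Proof.
(* The image of [x] is [true] or [false], which are the images of [1] and [0]. *)
case=> f /bij_inj injf x; case fx: (f x); [right|left]; apply: injf.
  by rewrite rmorph1.
by rewrite rmorph0.
Qed.

Theorem corollary6p8 (R : nzSemiRingType)
    (aicR : aic_semiring R) (latR : lattice_ordered R) :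
  [<-> (*   i *) ideal_simple R;
       (*  ii *) congruence_simple R;
       (* iii *) simple_semiring R;
       (*  iv *) semiring_isomorphic R boolean_semifield].
Proof.
(* The implications form the cycle (i), (ii), (iii), (iv), (i), and each passes through
   [zero_or_one R]. *)
tfae.
- move=> /(ideal_simple_zero_or_one latR); exact: zero_or_one_congruence_simple.
- move=> simR; split=> //; apply: zero_or_one_ideal_simple.
  exact: congruence_simple_zero_or_one.
- move=> [/(ideal_simple_zero_or_one latR) R01 _].
  exact: zero_or_one_isomorphic (aicR.1 1) R01.
- move=> /isomorphic_zero_or_one; exact: zero_or_one_ideal_simple.
Qed.
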